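(* Let $D\subseteq\mathbb{M}$ be a $\varnothing$-definable set that is cofinal, meaning that for every $c\in\mathbb{M}$ there exists some $d\in D$ such that $c\mid d$. Then $\operatorname{dcl} D=\mathbb{M}$.
   Context: $\mathbb{N}$ denotes the non-zero natural numbers, and $T$ is the complete first-order theory of the multiplicative monoid $(\mathbb{N},\cdot,1)$ (Skolem arithmetic). $\mathbb{M}\models T$ is a fixed monster model with $\mathbb{N}\prec\mathbb{M}$: a special structure of cardinality $\beth_{\mu^+}(\mu)$ for some suitably large cardinal $\mu$; ''small'' means of size $<\mu^+$. Write $v\mid w$ for $\exists u\,(w=v\cdot u)$. $\operatorname{dcl} B$ is the set of $a\in\mathbb{M}$ such that $\{a\}$ is definable by a first-order formula with parameters from $B$. *)

(* Defs.v *)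
From mathcomp Require Import all_boot.
From mathcomp Require Import boolp classical_sets functions cardinality wochoice.

Set Implicit Arguments.
Unset Strict Implicit.
Unset Printing Implicit Defensive.

Local Open Scope classical_set_scope.
Local Open Scope card_scope.

(** * First-order logic in the language of monoids *)

Inductive term (n : nat) : Type :=
| Var of 'I_n
| One
| Mul of term n & term n.
Arguments One {n}.

(* [formula n]: formulas with free variables among x_0, ..., x_(n-1).
   [Ex] binds x_0 of its body and shifts the other variables by one.
   The semantics is classical, so not/and/exists suffice. *)
Inductive formula : nat -> Type :=
| Eq n of term n & term n : formula n
| Not n of formula n : formula n
| And n of formula n & formula n : formula n
| Ex n of formula n.+1 : formula n.

Record structure : Type := Structure {
  carrier :> Type;
  one : carrier;
  mul : carrier -> carrier -> carrier }.

Arguments one {s}.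
Arguments mul {s}.

Section Semantics.
Variable M : structure.
Implicit Types (A B D L : set M).

Fixpoint eval n (e : n.-tuple M) (t : term n) : M :=
  match t with
  | Var i => tnth e i
  | One => one
  | Mul t u => mul (eval e t) (eval e u)
  end.

(* Satisfaction in the substructure of M with universe A: quantifiers range
   over A. Meaningful when A is [substructure] and e takes its values in A. *)
Fixpoint sat_in A n (phi : formula n) : n.-tuple M -> Prop :=
  match phi in formula n return n.-tuple M -> Prop with
  | Eq _ t u => fun e => eval e t = eval e u
  | Not _ phi => fun e => ~ sat_in A phi e
  | And _ phi psi => fun e => sat_in A phi e /\ sat_in A psi e
  | Ex _ phi => fun e => exists2 x : M, A x & sat_in A phi (cons_tuple x e)
  end.

Definition sat n (phi : formula n) (e : n.-tuple M) : Prop :=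
  sat_in [set: M] phi e.

Definition tuple_in A n (e : n.-tuple M) : Prop := forall i, A (tnth e i).

Definition substructure A : Prop :=
  A one /\ forall x y, A x -> A y -> A (mul x y).

Definition elementary_sub A B : Prop :=
  [/\ substructure A, substructure B, A `<=` B &
      forall n (phi : formula n) (e : n.-tuple M),
        tuple_in A e -> (sat_in A phi e <-> sat_in B phi e)].

(** ** Definable sets and definable closure *)

Definition definable0 D : Prop :=
  exists phi : formula 1, D = [set a | sat phi [tuple a]].

(* x_0 is the free variable of phi, the parameters b stand for x_1, ..., x_n. *)
Definition definable_over B D : Prop :=
  exists n (phi : formula n.+1) (b : n.-tuple M),
    tuple_in B b /\ D = [set a | sat phi (cons_tuple a b)].

Definition dcl B : set M := [set a | definable_over B [set a]].

Definition divides (v w : M) : Prop := exists u, w = mul v u.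

Definition cofinal D : Prop := forall c : M, exists2 d, D d & divides c d.

(** ** Saturation and special structures *)

(* Formulas phi(x_0, b) in the single free variable x_0, with parameters b. *)
Definition pformula : Type := {n : nat & (formula n.+1 * n.-tuple M)%type}.

Definition psat_in A (x : M) (q : pformula) : Prop :=
  sat_in A (projT2 q).1 (cons_tuple x (projT2 q).2).

Definition pformula_over B : set pformula :=
  [set q | tuple_in B (projT2 q).2].

Definition realised_in A (p : set pformula) : Prop :=
  exists2 x, A x & forall q, p q -> psat_in A x q.

(* The substructure A is |L|^+-saturated: every type over a set of parameters
   of cardinality < |L|^+, that is <= |L|, is realised. *)
Definition succ_saturated L A : Prop :=
  forall B, B `<=` A -> B #<= L ->
  forall p : set pformula, p `<=` pformula_over B ->
    (forall q, finite_set q -> q `<=` p -> realised_in A q) ->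
    realised_in A p.

(* M is the union of an elementary chain (M_lambda), for cardinals
   lambda < |M|, with M_lambda lambda^+-saturated. The cardinals lambda < |M|
   are represented by the subsets L of M of cardinality < |M|; monotonicity
   forces C L to depend on |L| only. *)
Definition below_card : set (set M) := [set L | ~~ ([set: M] #<= L)].

Definition special : Prop :=
  infinite_set [set: M] /\
  exists C : set M -> set M,
    [/\ forall L L', below_card L -> below_card L' -> L #<= L' ->
          elementary_sub (C L) (C L'),
        forall L, below_card L -> succ_saturated L (C L) &
        \bigcup_(L in below_card) C L = [set: M]].

End Semantics.

Definition elementary_embedding (M N : structure) (f : M -> N) : Prop :=
  forall n (phi : formula n) (e : n.-tuple M),
    sat phi e <-> sat phi (map_tuple f e).

(** * Skolem arithmetic *)

Definition pnat : Type := {n : nat | (0 < n)%N}.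

Definition pone : pnat := exist _ 1%N isT.

Definition pmul (m n : pnat) : pnat :=
  exist _ (sval m * sval n)%N
    (eq_trans (muln_gt0 (sval m) (sval n))
       (introT andP (conj (svalP m) (svalP n)))).

Definition skolem : structure := Structure pone pmul.

Definition theory (M : structure) : set (formula 0) :=
  [set phi | sat (M := M) phi [tuple]].

Definition models (M : structure) (T : set (formula 0)) : Prop :=
  forall phi, T phi -> sat (M := M) phi [tuple].

(** * The cardinal beth_(mu^+)(mu) *)

(* A type stands for its cardinality, and an ordinal for a well-ordered type
   (well_order is about non-strict orders). *)
Section Beth.
Variables (W : Type) (R : rel W).

Definition slt (v w : W) : Prop := ~~ R w v.

(* W has order type mu^+, the least ordinal of cardinality > mu. *)
Definition succ_cardinal_order (mu : Type) : Prop :=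
  [/\ well_order R,
      ~~ ([set: W] #<= [set: mu]) &
      forall w, [set v | slt v w] #<= [set: mu]].

Definition is_zero (w : W) : Prop := forall v, ~ slt v w.

Definition is_succ (v w : W) : Prop :=
  slt v w /\ forall u, slt u w -> R u v.

Definition is_limit (w : W) : Prop :=
  ~ is_zero w /\ forall v, ~ is_succ v w.

(* |Y| is the supremum of the |B v| for v in I. Every cardinal < |Y| is that
   of a subset of Y, so leastness can be tested on subsets of Y. *)
Definition card_sup (I : set W) (B : W -> Type) (Y : Type) : Prop :=
  (forall v, I v -> [set: B v] #<= [set: Y]) /\
  (forall S : set Y, (forall v, I v -> [set: B v] #<= S) -> [set: Y] #<= S).

(* B w has cardinality beth_w(mu) for all w in W. *)
Definition beth_sequence (mu : Type) (B : W -> Type) : Prop :=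
  [/\ forall w, is_zero w -> [set: B w] #= [set: mu],
      forall v w, is_succ v w -> [set: B w] #= [set: set (B v)] &
      forall w, is_limit w -> card_sup [set v | slt v w] B (B w)].

End Beth.

(* |Y| = beth_(mu^+)(mu); since mu is infinite, mu^+ is a limit ordinal. *)
Definition card_is_beth_succ (mu Y : Type) : Prop :=
  exists (W : Type) (R : rel W) (B : W -> Type),
    [/\ succ_cardinal_order R mu, beth_sequence R mu B &
        card_sup [set: W] B Y].

Definition monster_model (mu : Type) (M : structure) : Prop :=
  [/\ infinite_set [set: mu], models M (theory skolem), special M &
      card_is_beth_succ mu M].

(* Main.v *)
(** A formula of bounded complexity cannot distinguish x from x + n in (N,+)
    once x >= n, for a suitable n. Applied to the exponents at every prime
    separately, this gives for each phi an n > 0 such that phi(a^n u) implies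
    phi(a^n (a^n u)) in (N,.), hence in every model of T. Let phi define D. By
    cofinality some d = a^n u lies in D, so d' = a^n d lies in D as well, and a
    is the only solution x of x^n d = d'. *)

From mathcomp Require Import all_boot order ssralg ssrnum ssrint intdiv zify ring.
From mathcomp Require Import boolp classical_sets functions cardinality.
Require Import Defs.

(** * Back-and-forth for bounded linear conditions in Presburger arithmetic *)

Section Presburger.
Import Order.TTheory GRing.Theory Num.Theory.
Local Open Scope ring_scope.

Definition lin {n} (c : 'I_n -> int) (e : 'I_n -> nat) : int :=
  \sum_i c i * (e i)%:Z.

(* Agreement modulo M and on all inequalities with coefficients bounded by K and
   constant bounded by B. *)
Definition sim {n} (K B M : nat) (e e' : 'I_n -> nat) : Prop :=
  (forall i, (M%:Z %| (e i)%:Z - (e' i)%:Z)%Z) /\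
  forall (c : 'I_n -> int) (k : int),
    (forall i, `|c i| <= K%:Z) -> `|k| <= B%:Z ->
    (lin c e <= k) = (lin c e' <= k).

Definition fcons {n} (x : nat) (e : 'I_n -> nat) : 'I_n.+1 -> nat :=
  fun i => if unlift ord0 i is Some j then e j else x.

Lemma lin_fcons {n} c x (e : 'I_n -> nat) :
  lin c (fcons x e) = c ord0 * x%:Z + lin (c \o lift ord0) e.
Proof.
rewrite /lin big_ord_recl /fcons unlift_none; congr (_ + _).
by apply: eq_bigr => i _; rewrite liftK.
Qed.

Lemma linD {n} (c c' : 'I_n -> int) e :
  lin (fun i => c i + c' i) e = lin c e + lin c' e.
Proof. by rewrite /lin -big_split; apply: eq_bigr => i _; rewrite mulrDl. Qed.

Lemma linZ {n} a (c : 'I_n -> int) e : lin (fun i => a * c i) e = a * lin c e.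
Proof. by rewrite /lin mulr_sumr; apply: eq_bigr => i _; rewrite mulrA. Qed.

Lemma sim_refl {n} K B M (e : 'I_n -> nat) : sim K B M e e.
Proof. by split=> // i; rewrite subrr dvdz0. Qed.

Lemma sim_sym {n} {K B M} {e e' : 'I_n -> nat} : sim K B M e e' -> sim K B M e' e.
Proof.
case=> h1 h2; split=> [i|c k hc hk]; last by rewrite h2.
by rewrite -opprB rpredN.
Qed.

Lemma sim_trans {n} {K B M} {e1 e2 e3 : 'I_n -> nat} :
  sim K B M e1 e2 -> sim K B M e2 e3 -> sim K B M e1 e3.
Proof.
move=> [h1 h2] [h1' h2']; split=> [i|c k hc hk]; last by rewrite h2 // h2'.
by rewrite -(subrKA (e2 i)%:Z) rpredD.
Qed.

Lemma sim_weaken {n K B M K' B' M'} {e e' : 'I_n -> nat} :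
  (K <= K')%N -> (B <= B')%N -> (M %| M')%N -> sim K' B' M' e e' -> sim K B M e e'.
Proof.
move=> hK hB hM [h1 h2]; split=> [i|c k hc hk].
  by apply: dvdz_trans (h1 i); rewrite dvdzE.
by apply: h2 => [i|]; [move: (hc i)|]; lia.
Qed.

Lemma sim_lin_dvd {n K B M} {e e' : 'I_n -> nat} (c : 'I_n -> int) :
  sim K B M e e' -> (M%:Z %| lin c e - lin c e')%Z.
Proof.
case=> h _; rewrite /lin -sumrB; apply: rpred_sum => i _.
by rewrite -mulrBr; apply: dvdz_mull.
Qed.

(** These are the test points of quantifier elimination for [(N,+)]: points close to a zero of a
    form with bounded coefficients. Taking [c] positive only normalises the sign. *)
Definition near {n} (K B : nat) (e : 'I_n -> nat) (x : nat) : Prop :=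
  exists c (l : 'I_n -> int),
    [/\ 0 < c <= K%:Z, forall i, `|l i| <= K%:Z & `|c * x%:Z + lin l e| <= B%:Z].

(* While x is far from the zeros of all bounded forms, x - M behaves like x. *)
Lemma near_sim {n K B M} (e : 'I_n -> nat) x : (0 < K)%N -> (0 < M)%N ->
  exists2 x0, near K (B + K * M) e x0 & sim K B M (fcons x e) (fcons x0 e).
Proof.
move=> K0 M0; elim/ltn_ind: x => x IH.
case: (pselect (near K (B + K * M) e x)) => [hx|hx].
  by exists x => //; exact: sim_refl.
have far c (l : 'I_n -> int) : c != 0 -> `|c| <= K%:Z -> (forall i, `|l i| <= K%:Z) ->
    (B + K * M)%:Z < `|c * x%:Z + lin l e|.
  move=> c0 cK lK; rewrite ltNge; apply/negP => hle; apply: hx.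
  have [cp|cn] := ltrP 0 c; first by exists c, l; split => //; lia.
  exists (- c), (fun i => -1 * l i); split; first by lia.
    by move=> i; move: (lK i); lia.
  by rewrite linZ; move: hle; lia.
(* The form [x] itself is among the bounded forms, so a far [x] exceeds [B + K * M] and the
   subtraction [x - M] does not truncate. *)
have xM : (M <= x)%N.
  have : (B + K * M)%:Z < `|1 * x%:Z + lin (fun=> 0) e|.
    by apply: far => [//||i]; lia.
  rewrite /lin big1 => [|i _]; last by rewrite mul0r.
  by have : (M <= K * M)%N; [rewrite leq_pmull|lia].
have [|x0 hx0 hs] := IH (x - M)%N; first by lia.
exists x0 => //; apply: sim_trans hs; split=> [i|c k hc hk].
  rewrite /fcons; case: unliftP => [j _|_]; first by rewrite subrr dvdz0.
  by rewrite (_ : _ - _ = M%:Z) ?dvdzz //; lia.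
rewrite !lin_fcons; have [->|c0] := eqVneq (c ord0) 0; first by rewrite !mul0r.
(* Replacing [x] by [x - M] changes the form by at most [K * M], while its absolute value exceeds
   [B + K * M]; hence it does not cross [k]. *)
have := far _ (c \o lift ord0) c0 (hc _) (fun i => hc _).
set l := lin _ _; have -> : (x - M)%N%:Z = x%:Z - M%:Z by lia.
have : `|c ord0 * M%:Z| <= (K * M)%:Z.
  by rewrite normrM PoszM; apply: ler_pM => //; exact: hc.
rewrite mulrBr; lia.
Qed.

(** The answer [y] gives the form that witnesses nearness the same value [k] at [e'] as [x] gives it
    at [e]. The factor K! makes the division by [c] possible, and the other enlarged bounds absorb
    the elimination of the first variable. *)
Lemma near_back_forth {n K B B1 M} {e e' : 'I_n -> nat} x :
  (0 < K)%N -> sim (2 * K ^ 2) (K * (B + B1)) (M * K`!) e e' -> near K B1 e x ->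
  exists y, sim K B M (fcons x e) (fcons y e').
Proof.
move=> K0 hs [c [l [/andP[c0 cK] lK hB1]]].
have /dvdzP[q hq] : (M%:Z * c %| lin l e - lin l e')%Z.
  apply: dvdz_trans (sim_lin_dvd l hs); rewrite PoszM; apply: dvdz_mul => //.
  by rewrite dvdzE; apply: dvdn_fact; lia.
set k := c * x%:Z + lin l e in hB1.
(* A shift by a multiple of [M] keeps the residue; the quotient [q] makes it compensate for the
   change from [lin l e] to [lin l e']. *)
pose y := x%:Z + M%:Z * q.
have cy : c * y = k - lin l e'.
  rewrite /y /k mulrDr; have -> : lin l e = lin l e' + q * (M%:Z * c).
    by rewrite -hq; ring.
  by ring.
have KK : (K <= 2 * K ^ 2)%N by rewrite -{1}(expn1 K); nia.
have BB : (B1 <= K * (B + B1))%N by nia.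
(* Since [c * y = k - lin l e'], this is the inequality [lin l e' <= k], transferred from
   [lin l e <= k], which holds because [c * x] is nonnegative. *)
have y0 : 0 <= y.
  rewrite -(pmulr_rge0 _ c0) cy subr_ge0 -(hs.2 l k); last by lia.
    by rewrite /k lerDr mulr_ge0 // ltW.
  by move=> i; move: (lK i); lia.
exists `|y|%N; have yE : (`|y|%N)%:Z = y by lia.
split=> [i|c2 k2 hc2 hk2].
  rewrite /fcons; case: unliftP => [j _|_].
    by apply: dvdz_trans (hs.1 j); rewrite dvdzE dvdn_mulr.
  by rewrite yE /y opprD addrA subrr add0r rpredN dvdz_mulr.
rewrite !lin_fcons yE -(ler_pM2l c0) -[RHS](ler_pM2l c0).
(* Eliminate the first variable: multiply by c and substitute c y = k - l e'. *)
set c2' := c2 \o lift ord0; pose l3 i := c * c2' i + - c2 ord0 * l i.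
have E (z : int) f : c * z = k - lin l f ->
    (c * (c2 ord0 * z + lin c2' f) <= c * k2) =
    (lin l3 f <= c * k2 - c2 ord0 * k).
  move=> hz; rewrite /l3 linD !linZ mulrDr mulrCA hz.
  by rewrite -subr_ge0 -[RHS]subr_ge0; congr (0 <= _); ring.
rewrite !E //; last by rewrite /k; ring.
(* Each coefficient of [l3] is a sum of two products bounded by [K ^ 2], and the new constant is
   bounded by [K * B + K * B1]. *)
apply: hs.2 => [i|].
  have h1 : `|c * c2' i| <= K%:Z * K%:Z.
    by rewrite normrM; apply: ler_pM => //; [lia|exact: hc2].
  have h2 : `|c2 ord0 * l i| <= K%:Z * K%:Z.
    by rewrite normrM; apply: ler_pM => //; exact: hc2.
  rewrite /l3; lia.
have h1 : `|c * k2| <= K%:Z * B%:Z.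
  by rewrite normrM; apply: ler_pM => //; lia.
have h2 : `|c2 ord0 * k| <= K%:Z * B1%:Z.
  by rewrite normrM; apply: ler_pM => //; exact: hc2.
lia.
Qed.

(** First [x] is moved down to a near point, then that point is answered; [B + K * M] is the radius
    of nearness reached by the descent. *)
Lemma sim_back_forth n K B M : (0 < K)%N -> (0 < M)%N ->
  exists K' B' M', [/\ (0 < K')%N, (0 < M')%N &
    forall e e' : 'I_n -> nat, sim K' B' M' e e' ->
    forall x, exists y, sim K B M (fcons x e) (fcons y e')].
Proof.
move=> K0 M0.
exists (2 * K ^ 2)%N, (K * (B + (B + K * M)))%N, (M * K`!)%N; split.
- by rewrite muln_gt0 expn_gt0 K0.
- by rewrite muln_gt0 M0 fact_gt0.
- move=> e e' hs x; have [x0 hx0 h0] := near_sim e x K0 M0 (B := B).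
  by have [y hy] := near_back_forth x0 K0 hs hx0; exists y; apply: sim_trans hy.
Qed.

End Presburger.

(** * From exponents at each prime to formulas of Skolem arithmetic *)

Section PrimeExponents.
Import Order.TTheory GRing.Theory Num.Theory Defs.
Local Open Scope ring_scope.

Definition expo {n} (p : nat) (e : n.-tuple skolem) : 'I_n -> nat :=
  fun i => logn p (sval (tnth e i)).

Lemma expo_cons {n} p x (e : n.-tuple skolem) :
  expo p (cons_tuple x e) = fcons (logn p (sval x)) (expo p e).
Proof.
apply: funext => i; rewrite /fcons /expo.
by case: unliftP => [j ->|->]; [rewrite tnthS|rewrite tnth0].
Qed.

Lemma skolem_gt0 (x : skolem) : (0 < sval x)%N.
Proof. by case: x. Qed.

Lemma skolem_inj (x y : skolem) :
  (forall p, logn p (sval x) = logn p (sval y)) -> x = y.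
Proof.
case: x y => [m m0] [n n0] /= h; have E : m = n by apply: eqn_from_log h.
by subst n; rewrite (bool_irrelevance m0 n0).
Qed.

(** The cut-off [N] is needed because a positive integer has only finitely many prime factors. *)
Lemma skolem_of_expo (f : nat -> nat) (N : nat) :
  exists x : skolem, forall p,
    logn p (sval x) = if prime p && (p < N)%N then f p else 0%N.
Proof.
elim: N => [|N [x hx]].
  by exists pone => p; rewrite logn1 ltn0 andbF.
have [pN|npN] := boolP (prime N); last first.
  exists x => p; rewrite hx ltnS (leq_eqVlt p).
  by case: eqP => // ->; rewrite (negbTE npN).
have pos : (0 < N ^ f N)%N by rewrite expn_gt0 prime_gt0.
exists (pmul x (exist _ (N ^ f N)%N pos)) => p /=.
rewrite lognM ?skolem_gt0 // hx lognX logn_prime // ltnS (leq_eqVlt p).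
case: eqP => [->|_]; first by rewrite pN ltnn /= muln1.
by rewrite muln0 addn0.
Qed.

(** A term is a monomial, and these are its degrees: the coefficients of the linear form that gives
    the exponent of its value at any prime. *)
Fixpoint term_deg {n} (t : term n) : 'I_n -> nat :=
  match t with
  | Var j => fun i => i == j
  | One => fun=> 0
  | Mul t u => fun i => (term_deg t i + term_deg u i)%N
  end.

Lemma logn_eval {n} p (e : n.-tuple skolem) (t : term n) :
  (logn p (sval (eval e t)))%:Z = lin (fun i => (term_deg t i)%:Z) (expo p e).
Proof.
elim: t => [j||t IHt u IHu] /=.
- rewrite /lin (bigD1 j) //= eqxx mul1r big1 ?addr0 // => i /negbTE ->.
  by rewrite mul0r.
- by rewrite logn1 /lin big1 // => i _; rewrite mul0r.
- rewrite lognM ?skolem_gt0 //.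
  by rewrite PoszD IHt IHu -linD.
Qed.

(** An equation holds iff at every prime the difference [c] of the two linear forms vanishes, that
    is, [c] and its negative are both at most 0. [K] bounds these coefficients. *)
Lemma sat_Eq_sim {n} (t u : term n) : exists K, forall e e' : n.-tuple skolem,
  (forall p, sim K 0 1 (expo p e) (expo p e')) ->
  eval e t = eval e u -> eval e' t = eval e' u.
Proof.
pose K := (\sum_i (term_deg t i + term_deg u i))%N.
have hK i : (term_deg t i + term_deg u i <= K)%N by rewrite /K (bigD1 i) // leq_addr.
exists K => e e' hs htu; apply: skolem_inj => p.
pose c i := (term_deg t i)%:Z + -1 * (term_deg u i)%:Z.
have cE f : lin c (expo p f) =
    (logn p (sval (eval f t)))%:Z - (logn p (sval (eval f u)))%:Z.
  by rewrite linD linZ -!logn_eval mulN1r.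
have h1 := (hs p).2 c 0; have h2 := (hs p).2 (fun i => -1 * c i) 0.
rewrite !linZ in h2; rewrite !cE htu in h1 h2.
have {}h1 := h1 _ isT; have {}h2 := h2 _ isT.
have c1 i : `|c i| <= K by rewrite /c; move: (hK i); lia.
have c2 i : `|-1 * c i| <= K by rewrite mulN1r normrN.
move: (h1 c1) (h2 c2); lia.
Qed.

(* Feferman-Vaught for the weak direct power (N,+)^(primes): a play of the
   Ehrenfeucht-Fraisse game is answered separately at each prime, with
   exponent 0 wherever all the elements in sight have exponent 0. *)
Lemma sat_sim {n} (phi : formula n) : exists K B M,
  [/\ (0 < K)%N, (0 < M)%N & forall e e' : n.-tuple skolem,
    (forall p, sim K B M (expo p e) (expo p e')) -> sat phi e -> sat phi e'].
Proof.
rewrite /sat.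
elim: phi => {n} [n t u|n phi [K [B [M [K0 M0 IH]]]]|n phi [K [B [M [K0 M0 IH]]]]
  psi [K' [B' [M' [K0' M0' IH']]]]|n phi [K [B [M [K0 M0 IH]]]]].
- have [K hK] := sat_Eq_sim t u; exists K.+1, 0%N, 1%N; split=> // e e' hs.
  by apply: hK => p; apply: sim_weaken (hs p).
- exists K, B, M; split=> // e e' hs /= nphi phi'; apply: nphi.
  by apply: IH phi' => p; apply: sim_sym.
- exists (K + K')%N, (B + B')%N, (M * M')%N; split; [lia|lia|] => e e' hs /= [h h'].
  split; [apply: IH h|apply: IH' h'] => p; apply: sim_weaken (hs p).
  + exact: leq_addr.
  + exact: leq_addr.
  + exact: dvdn_mulr.
  + exact: leq_addl.
  + exact: leq_addl.
  + exact: dvdn_mull.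
- have [K' [B' [M' [K0' M0' bf]]]] := sim_back_forth n K B M K0 M0.
  exists K', B', M'; split=> // e e' hs /= [x _ hx].
  have [f hf] := choice (fun p => bf _ _ (hs p) (logn p (sval x))).
  (* [N] exceeds [x] and all entries of [e] and [e'], so no prime from [N] on divides any of them,
     and there both sides of the game coincide. *)
  pose N := (sval x + \sum_i (sval (tnth e i) + sval (tnth e' i))).+1%N.
  have [y hy] := skolem_of_expo f N.
  exists y => //; apply: IH hx => p; rewrite !expo_cons hy.
  case: ifP => // /negbT pN; have big0 m : (m < N)%N -> logn p m = 0%N.
    move=> mN; move: pN; rewrite negb_and -leqNgt => /orP[np|Np].
      by rewrite lognE (negbTE np).
    by rewrite ltn_log0 // (leq_trans mN).
  have le_N i : (sval (tnth e i) + sval (tnth e' i) < N)%N.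
    by rewrite /N (bigD1 i) //= ltnS; lia.
  have -> : expo p e' = expo p e.
    by apply: funext => i; rewrite /expo !big0 //; move: (le_N i); lia.
  by rewrite big0; [exact: sim_refl|rewrite /N ltnS leq_addr].
Qed.

(** * Pumping in the standard model *)

Definition mpow {M : structure} (n : nat) (x : M) : M := iter n (mul x) one.

Lemma sval_mpow n (x : skolem) : sval (mpow n x) = (sval x ^ n)%N.
Proof. by elim: n => //= n IH; rewrite -/(mpow n x) IH expnS. Qed.

(** At a prime where [a] has exponent [v], pumping adds [n * v] to an exponent that is already at
    least [n * v]. As [M] divides [n], residues are kept. If [v = 0] nothing changes; otherwise both
    exponents exceed [B], and for nonzero [c] the sign of [c] alone decides the bounded
    inequality. *)
Lemma skolem_pumping (phi : formula 1) : exists2 n, (0 < n)%N &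
  forall a u : skolem, sat phi [tuple mul (mpow n a) u] ->
    sat phi [tuple mul (mpow n a) (mul (mpow n a) u)].
Proof.
have [K [B [M [K0 M0 hphi]]]] := sat_sim phi.
exists (M * B.+1)%N; first by rewrite muln_gt0 M0.
move=> a u; apply: hphi => p; set n := (M * B.+1)%N.
have pos (x : skolem) m : (0 < sval x ^ m)%N by rewrite expn_gt0 skolem_gt0.
have expE : forall i, expo p [tuple mul (mpow n a) (mul (mpow n a) u)] i =
    (expo p [tuple mul (mpow n a) u] i + n * logn p (sval a))%N /\
    (n * logn p (sval a) <= expo p [tuple mul (mpow n a) u] i)%N.
  move=> i; rewrite /expo !(tnth_nth one) ord1 /= sval_mpow !lognM ?muln_gt0 ?pos //;
    rewrite ?skolem_gt0 // lognX; lia.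
set e := expo p _ in expE *; set e' := expo p _ in expE *.
split=> [i|c k hc hk].
  by rewrite (expE i).1 PoszD opprD addrA subrr add0r rpredN dvdzE /= -mulnA dvdn_mulr.
rewrite /lin !big_ord_recl !big_ord0 !addr0.
have [-> le] := expE ord0.
have [->|c0] := eqVneq (c ord0) 0; first by rewrite !mul0r.
have [->|l0] := eqVneq (logn p (sval a)) 0%N; first by rewrite muln0 addn0.
have : (B < n * logn p (sval a))%N.
  by rewrite /n -mulnA mulnCA; nia.
by nia.
Qed.

End PrimeExponents.

(** * Renaming of variables and transfer to models of the theory *)

Fixpoint trename {n m} (f : 'I_n -> 'I_m) (t : term n) : term m :=
  match t with
  | Var i => Var (f i)
  | One => One
  | Mul t u => Mul (trename f t) (trename f u)
  end.

Definition lift_ren {n m} (f : 'I_n -> 'I_m) : 'I_n.+1 -> 'I_m.+1 :=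
  fun i => if unlift ord0 i is Some j then lift ord0 (f j) else ord0.

(** This lets one sentence assert the one-variable formula [phi] at several of its bound
    variables. *)
Fixpoint rename {n} (phi : formula n) : forall {m}, ('I_n -> 'I_m) -> formula m :=
  match phi in formula n return forall m, ('I_n -> 'I_m) -> formula m with
  | Eq _ t u => fun m f => Eq (trename f t) (trename f u)
  | Not _ phi => fun m f => Not (rename phi f)
  | And _ phi psi => fun m f => And (rename phi f) (rename psi f)
  | Ex _ phi => fun m f => Ex (rename phi (lift_ren f))
  end.

Lemma eval_trename {M : structure} {n m} {f : 'I_n -> 'I_m} (t : term n)
    {e : m.-tuple M} {e' : n.-tuple M} :
  (forall i, tnth e' i = tnth e (f i)) -> eval e (trename f t) = eval e' t.
Proof. by move=> h; elim: t => [i||t IHt u IHu] //=; rewrite ?h ?IHt ?IHu. Qed.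

Lemma sat_rename {M : structure} {n m} (phi : formula n) {f : 'I_n -> 'I_m}
    {e : m.-tuple M} {e' : n.-tuple M} :
  (forall i, tnth e' i = tnth e (f i)) -> sat (rename phi f) e <-> sat phi e'.
Proof.
rewrite /sat; elim: phi m f e e' => {n} [n t u|n phi IH|n phi IH psi IH'|n phi IH]
  m f e e' h /=.
- by rewrite !(eval_trename _ h).
- by rewrite (IH _ _ _ _ h).
- by rewrite (IH _ _ _ _ h) (IH' _ _ _ _ h).
- have hx x i : tnth (cons_tuple x e') i = tnth (cons_tuple x e) (lift_ren f i).
    rewrite /lift_ren; case: unliftP => [j ->|->]; last by rewrite !tnth0.
    by rewrite !tnthS.
  by split=> -[x _ /(IH _ _ _ _ (hx x)) h']; exists x.
Qed.

Fixpoint term_pow {n} (k : nat) (t : term n) : term n :=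
  if k is k.+1 then Mul t (term_pow k t) else One.

Lemma eval_term_pow {M : structure} {n} (e : n.-tuple M) k (t : term n) :
  eval e (term_pow k t) = mpow k (eval e t).
Proof. by elim: k => //= k ->. Qed.

(** Meant for [k <= n]: [inord] sends any larger index to variable 0. *)
Definition var {n} (k : nat) : term n.+1 := Var (inord k).

(** For a fixed standard [n] the power [mpow n] is given by a term, so the pumping property is a
    single sentence [S], which belongs to the theory. *)
Lemma pumping_transfer {M : structure} (phi : formula 1) n :
  models M (theory skolem) ->
  (forall a u : skolem, sat phi [tuple mul (mpow n a) u] ->
     sat phi [tuple mul (mpow n a) (mul (mpow n a) u)]) ->
  forall a u : M, sat phi [tuple mul (mpow n a) u] ->
     sat phi [tuple mul (mpow n a) (mul (mpow n a) u)].
Proof.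
(* In the scope of the four quantifiers the variables are (d', d, u, a). *)
pose phi_at k := rename phi (fun=> inord k : 'I_4).
pose S := Not (Ex (Ex (Ex (Ex
  (And (And (Eq (var 1) (Mul (term_pow n (var 3)) (var 2)))
            (Eq (var 0) (Mul (term_pow n (var 3)) (var 1))))
       (And (phi_at 1) (Not (phi_at 0)))))))).
have S_sat (N : structure) : sat S ([tuple] : 0.-tuple N) <->
    forall a u : N, sat phi [tuple mul (mpow n a) u] ->
      sat phi [tuple mul (mpow n a) (mul (mpow n a) u)].
  pose env (a u d d' : N) :=
    cons_tuple d' (cons_tuple d (cons_tuple u (cons_tuple a [tuple]))).
  have atE a u d d' k : k < 4 ->
      sat (phi_at k) (env a u d d') <-> sat phi [tuple nth one (env a u d d') k].
    move=> hk; apply: sat_rename => i.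
    by rewrite ord1 (tnth_nth one) /= (tnth_nth one) inordK.
  split=> [h a u hd|h].
    apply: contrapT => hd'; apply: h.
    exists a => //; exists u => //; exists (mul (mpow n a) u) => //.
    exists (mul (mpow n a) (mul (mpow n a) u)) => //; split; split.
    + by rewrite /= !eval_term_pow /= !(tnth_nth one) /= !inordK //.
    + by rewrite /= !eval_term_pow /= !(tnth_nth one) /= !inordK //.
    + exact: (atE a u _ _ 1 isT).2 hd.
    + by move/(atE a u _ _ 0 isT).1.
  move=> [a _ [u _ [d _ [d' _ [[e1 e2] [h1 h2]]]]]].
  rewrite /= !eval_term_pow /= !(tnth_nth one) /= !inordK //= in e1 e2.
  apply: h2; apply: (atE a u d d' 0 isT).2; rewrite /= e2 e1; apply: h.
  by rewrite -e1; exact: (atE a u d d' 1 isT).1 h1.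
by move=> hM /S_sat hS; apply/S_sat; apply: hM.
Qed.

(** Again one sentence suffices. It holds in the standard model by cancelling [d] and by injectivity
    of the n-th power for positive [n]. *)
Lemma cancel_transfer {M : structure} n : 0 < n -> models M (theory skolem) ->
  forall d x y : M, mul (mpow n x) d = mul (mpow n y) d -> x = y.
Proof.
move=> n0 hM.
(* Under the three quantifiers the variables are [(y, x, d)]. *)
pose S := Not (Ex (Ex (Ex
  (And (Eq (Mul (term_pow n (var 1)) (var 2)) (Mul (term_pow n (var 0)) (var 2)))
       (Not (Eq (var 1) (var 0 : term 3))))))).
have S_sat (N : structure) : sat S ([tuple] : 0.-tuple N) <->
    forall d x y : N, mul (mpow n x) d = mul (mpow n y) d -> x = y.
  split=> [h d x y E|h [d _ [x _ [y _ []]]]].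
    apply: contrapT => nE; apply: h.
    exists d => //; exists x => //; exists y => //=.
    by rewrite /= !eval_term_pow /= !(tnth_nth one) /= !inordK //.
  rewrite /= !eval_term_pow /= !(tnth_nth one) /= !inordK //=.
  by move=> /h.
apply/S_sat; apply: hM; apply/S_sat => d x y /(congr1 sval) /= /eqP.
rewrite !sval_mpow eqn_pmul2r ?skolem_gt0 // eqn_exp2r // => /eqP E.
by apply: skolem_inj => p; rewrite E.
Qed.

(** * Definability of each element from two elements of the cofinal set *)

Local Open Scope classical_set_scope.

Theorem lemma2p15 (mu : Type) (M : structure) (hM : monster_model mu M)
    (j : skolem -> M) (hj : elementary_embedding j)
    (D : set M) (hD : definable0 D) (hcof : cofinal D) :
  dcl D = [set: M].
Proof.
have [_ hT _ _] := hM; have [phi DE] := hD.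
have [n n0 /(pumping_transfer phi n hT) pump] := skolem_pumping phi.
apply/seteqP; split=> // a _.
have [d Dd [u dE]] := hcof (mpow n a).
pose d' := mul (mpow n a) d.
have Dd' : D d' by move: Dd; rewrite DE /d' dE; apply: pump.
(* Variable 0 is the unknown, while 1 and 2 stand for the parameters [d] and [d']. *)
exists 2, (Eq (var 2) (Mul (term_pow n (var 0)) (var 1))), [tuple d; d']; split.
  by move=> i; rewrite (tnth_nth one); case: i => -[|[|]].
have satE x : sat (Eq (var 2) (Mul (term_pow n (var 0)) (var 1)))
    (cons_tuple x [tuple d; d']) <-> d' = mul (mpow n x) d.
  by rewrite /sat /= !eval_term_pow /= !(tnth_nth one) /= !inordK //.
apply/seteqP; split=> [x ->|x /satE E]; first exact/satE.
exact: (cancel_transfer n n0 hT d x a (esym E)).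
Qed.
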